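(* Let $G$ be a finite group. Then $G$ is nilpotent if and only if $|(xy)^G|=|x^G|\,|y^G|$ for every $x,y\in G$ of prime power order with $(o(x),o(y))=1$.
   Context: For $g\in G$, $g^G$ denotes the conjugacy class of $g$ in $G$, $o(g)$ denotes the order of $g$, and $(m,n)$ denotes the greatest common divisor of the integers $m,n$. *)

(* Defs.v *)
From mathcomp Require Import all_boot all_fingroup all_solvable.

Set Implicit Arguments.
Unset Strict Implicit.
Unset Printing Implicit Defensive.

(* The exponent may be 0, so 1 counts as a prime power and the identity
   element has prime power order. *)
Definition prime_power (n : nat) : Prop :=
  exists p k : nat, prime p /\ n = p ^ k.

(* Main.v *)
Require Import Defs.
From mathcomp Require Import all_boot all_fingroup all_solvable.

(** Both directions compare the class of [x * y] with the set of pairs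
    [(x ^: G) x (y ^: G)], which multiplication maps into [G].

    Suppose that [|(xy)^G| = |x^G| |y^G|].  Every conjugate of [x * y] is a
    product of a conjugate of [x] and a conjugate of [y], so the image of the
    multiplication map has at least as many elements as its domain, and the
    map is injective.  Conjugation by [x * y] fixes [x * y], so the pairs
    [(x, y)] and [(x, y) ^ (x * y)] have the same product; hence [x * y]
    centralises [x], and [x] and [y] commute ([card_classM_commute]).  The
    class size condition thus makes every p-element commute with every
    q-element when [p != q].  A Sylow p-subgroup is then centralised by the
    Sylow q-subgroups for all [q != p], so it is normal, and a group whose
    Sylow subgroups are all normal is nilpotent
    ([nilpotent_prime_power_commute]).

    Conversely, let [G] be nilpotent and [x], [y] have coprime orders.  They
    commute, and both are powers of [x * y], so the centraliser of [x * y] is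
    the intersection of those of [x] and [y].  These two centralisers contain
    complementary Hall subgroups, so their product is [G], and the index of
    the intersection is the product of the indices
    ([nilpotent_card_classM]). *)

Set Implicit Arguments.
Unset Strict Implicit.
Unset Printing Implicit Defensive.

Section ClassSizes.

Local Open Scope group_scope.

Variable gT : finGroupType.
Implicit Types (G P Q : {group gT}) (x y : gT) (p q : nat).

(** Equality of sizes forces multiplication to be injective on
    [x ^: G] x [y ^: G]; injectivity is then applied to [(x, y)] and its
    conjugate by [x * y]. *)
Lemma card_classM_commute G x y :
    x \in G -> y \in G ->
  #|(x * y) ^: G| = (#|x ^: G| * #|y ^: G|)%N -> commute x y.
Proof.
move=> Gx Gy card_xy.
pose mul_pair (u : gT * gT) := u.1 * u.2.
have /imset_injP inj_mul : #|mul_pair @: setX (x ^: G) (y ^: G)|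
                             == #|setX (x ^: G) (y ^: G)|.
  rewrite eqn_leq leq_imset_card cardsX -card_xy subset_leq_card //.
  apply/subsetP=> _ /imsetP[g Gg ->]; apply/imsetP.
  by exists (x ^ g, y ^ g); rewrite ?conjMg // inE !memJ_class.
have Gxy : x * y \in G by rewrite groupM.
have [xJ _] : (x ^ (x * y), y ^ (x * y)) = (x, y).
  apply: inj_mul; first by rewrite inE !memJ_class.
    by rewrite inE !class_refl.
  by rewrite /mul_pair /= -conjMg conjgE mulKg.
by move: xJ; rewrite conjgM (conjgE x x) mulKg => /conjg_fixP/commgP.
Qed.

(** For each [q != p], [P] is normalised by a full Sylow q-subgroup, and [P]
    normalises itself; so the order of its normaliser is divisible by every
    prime part of the order of [G]. *)
Lemma normal_Sylow_prime_power_commute G P p :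
    {in G &, forall x y, prime_power #[x] -> prime_power #[y] ->
       coprime #[x] #[y] -> commute x y} ->
  p.-Sylow(G) P -> P <| G.
Proof.
move=> comG sylP; have sPG := pHall_sub sylP.
have p_power q Q x : prime q -> q.-group Q -> x \in Q -> prime_power #[x].
  move=> q_pr qQ Qx; have /p_natP[k ox] := mem_p_elt qQ Qx.
  by exists q, k.
rewrite /normal sPG; have [->|ntP] := eqVneq (P : {set gT}) 1.
  exact: norms1.
have [p_pr _ _] := pgroup_pdiv (pHall_pgroup sylP) ntP.
suffices: #|G| %| #|'N_G(P)|.
  move/(dvdn_leq (cardG_gt0 _)) => le_GN.
  have /eqP <- : 'N_G(P) == G by rewrite eqEcard subsetIl.
  exact: subsetIr.
apply/dvdn_partP=> [|q]; first exact: cardG_gt0.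
rewrite mem_primes => /and3P[q_pr _ _].
have [->|neq_qp] := eqVneq q p.
  by rewrite -(card_Hall sylP) cardSg // subsetI sPG normG.
have [Q sylQ] := Sylow_exists q G.
rewrite -(card_Hall sylQ) cardSg // subsetI (pHall_sub sylQ).
apply: cents_norm; apply/centsP=> y Qy x Px.
have [sQG qQ _] := and3P sylQ; have pP := pHall_pgroup sylP.
have [qy px] := (mem_p_elt qQ Qy, mem_p_elt pP Px).
apply: comG; first exact: (subsetP sQG).
- exact: (subsetP sPG).
- exact: p_power q_pr qQ Qy.
- exact: p_power p_pr pP Px.
apply: (pnat_coprime qy); apply: sub_in_pnat px => r _ /eqnP->.
by rewrite !inE eq_sym.
Qed.

Lemma nilpotent_prime_power_commute G :
    {in G &, forall x y, prime_power #[x] -> prime_power #[y] ->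
       coprime #[x] #[y] -> commute x y} ->
  nilpotent G.
Proof.
move=> comG; suffices <- : 'F(G) = G by apply: Fitting_nil.
apply/eqP; rewrite eqEsubset Fitting_sub -{1}[G : {set gT}]Sylow_gen gen_subG.
apply/bigcupsP=> P /SylowP[p _ sylP]; apply: Fitting_max.
  exact: normal_Sylow_prime_power_commute comG sylP.
exact: pgroup_nil (pHall_pgroup sylP).
Qed.

(** The constituents of [x * y] at the primes dividing, and at the primes not
    dividing, the order of [x] are [x] and [y]; they are powers of [x * y]. *)
Lemma cent1M_coprime x y :
  commute x y -> coprime #[x] #[y] -> 'C[x * y] = 'C[x] :&: 'C[y].
Proof.
move=> cxy co_xy; apply/eqP; rewrite eqEsubset; apply/andP; split; last first.
  by apply/subsetP=> z /setIP[/cent1P zx /cent1P zy]; apply/cent1P/commuteM.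
have x_pi : \pi(#[x]).-elt x by apply: pnat_pi.
have y_pi' : \pi(#[x])^'.-elt y by rewrite /p_elt -coprime_pi'.
have x_constt : (x * y).`_(\pi(#[x])) = x.
  by rewrite consttM // constt_p_elt // (constt1P y_pi') mulg1.
have y_constt : (x * y).`_(\pi(#[x])^') = y.
  rewrite consttM // (constt_p_elt y_pi') (constt1P _) ?mul1g //.
  by rewrite /p_elt pnatNK.
rewrite -!cent_cycle subsetI !centS // cycle_subG.
  by rewrite -{1}y_constt cycle_constt.
by rewrite -{1}x_constt cycle_constt.
Qed.

(** With [pi] the set of primes dividing the order of [x], the pi'-core of [G]
    centralises [x] and the pi-core centralises [y], so the two centralisers
    multiply to [G]. *)
Lemma nilpotent_card_classM G x y :
    nilpotent G -> x \in G -> y \in G -> coprime #[x] #[y] ->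
  #|(x * y) ^: G| = (#|x ^: G| * #|y ^: G|)%N.
Proof.
move=> nilG Gx Gy co_xy; pose pi := \pi(#[x]).
have [sxG syG] : <[x]> \subset G /\ <[y]> \subset G by rewrite !cycle_subG.
have cxy : commute x y.
  have /centsP := sub_nilpotent_cent2 nilG sxG syG co_xy.
  by move=> cyx; apply/commute_sym/cyx; apply: cycle_id.
have x_pi : pi.-nat #[x] by apply: pnat_pi.
have y_pi' : pi^'.-nat #[y] by rewrite -coprime_pi'.
have CxCy : 'C_G[y] * 'C_G[x] = G.
  apply/eqP; rewrite eqEsubset mul_subG ?subsetIl //=.
  have [_ defG _ _] := dprodP (nilpotent_pcoreC pi nilG).
  rewrite -{1}defG mulgSS // subsetI pcore_sub -cent_cycle.
    rewrite (sub_nilpotent_cent2 nilG) ?pcore_sub //.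
    by rewrite coprime_sym (pnat_coprime (pcore_pgroup _ _)).
  rewrite (sub_nilpotent_cent2 nilG) ?pcore_sub //.
  by rewrite (pnat_coprime x_pi) // [_.-nat _]pcore_pgroup.
have cardCI : (#|'C_G[x]| * #|'C_G[y]| = #|G| * #|'C_G[x * y]|)%N.
  by rewrite cent1M_coprime // setIIr [in RHS]setIC mulnC mul_cardG CxCy.
have card_class z : (#|'C_G[z]| * #|z ^: G| = #|G|)%N.
  by rewrite -index_cent1 Lagrange ?subsetIl.
have CC_gt0 : 0 < #|'C_G[x]| * #|'C_G[y]| by rewrite muln_gt0 !cardG_gt0.
apply/eqP; rewrite -(eqn_pmul2l CC_gt0).
by rewrite mulnACA !card_class cardCI -mulnA card_class.
Qed.

End ClassSizes.

Theorem theoremA (gT : finGroupType) (G : {group gT}) :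
  nilpotent G <->
  (forall x y : gT, x \in G -> y \in G ->
     prime_power #[x]%g -> prime_power #[y]%g -> coprime #[x]%g #[y]%g ->
     #|((x * y) ^: G)%g| = #|(x ^: G)%g| * #|(y ^: G)%g|).
Proof.
split=> [nilG x y Gx Gy _ _ | class_size].
  exact: nilpotent_card_classM.
apply: nilpotent_prime_power_commute => x y Gx Gy x_pp y_pp co_xy.
by apply: (card_classM_commute Gx Gy); apply: class_size.
Qed.
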